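(* Let $\mathcal{H}$ be a real Hilbert space, let $A\colon\mathcal{H}\rightrightarrows\mathcal{H}$ be maximally monotone and let $B\colon\mathcal{H}\to\mathcal{H}$ be monotone and $L$-Lipschitz continuous (with $L>0$), with $\operatorname{zer}(A+B)\neq\varnothing$. Let $\varepsilon>0$, let $\lambda\in\left[\varepsilon,\frac{1-3\varepsilon}{3L}\right]$ and let $x_0,x_{-1}\in\mathcal{H}$. Let $(x_k)$ be the sequence generated by $$x_{k+1}=J_{\lambda A}\bigl(x_k-\lambda B(x_k)\bigr)-\lambda\bigl(B(x_k)-B(x_{k-1})\bigr),\qquad k=0,1,2,\dots.$$ Then there exists $\bar{x}\in\operatorname{zer}(A+B)$ such that: (i) $(x_k)$ converges weakly to $\bar{x}$; (ii) $(B(x_k))$ converges weakly to $B(\bar{x})$.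
   Context: For a set-valued operator $M\colon\mathcal{H}\rightrightarrows\mathcal{H}$, $\operatorname{zer}(M)=\{x\in\mathcal{H}:0\in M(x)\}$, and $J_M=(\mathrm{Id}+M)^{-1}$ denotes its resolvent, which is single-valued with full domain when $M$ is maximally monotone. *)

(* Defs.v *)
(* MathComp world, with MathComp-Analysis. *)
From HB Require Import structures.
From mathcomp Require Import all_boot all_order all_algebra.
From mathcomp Require Import all_classical all_reals all_analysis.

Set Implicit Arguments.
Unset Strict Implicit.
Unset Printing Implicit Defensive.

Import Order.TTheory GRing.Theory Num.Theory.
Import numFieldNormedType.Exports.

Local Open Scope classical_set_scope.
Local Open Scope ring_scope.

(* A real Hilbert space is a complete normed module [H] over a [realType]
   together with a real inner product [dot : {dot H for idfun}] that induces
   the norm of [H]. *)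
Definition induces_norm (R : realType) (H : normedModType R)
    (dot : {dot H for (@idfun R)}) : Prop :=
  forall x : H, `|x| = Num.sqrt (dot x x).

(* A set-valued operator is a map [M : H -> set H]; its graph is the set of
   pairs [(x, u)] such that [M x u]. *)
Section SetValuedOperators.
Variables (R : realType) (H : normedModType R).
Implicit Types (M N : H -> set H) (f : H -> H) (x y : H).

Definition op_of_fun f : H -> set H := fun x => [set f x].

Definition op_add M N : H -> set H :=
  fun x => [set u + v | u in M x & v in N x].

Definition op_scale (a : R) M : H -> set H :=
  fun x => [set a *: u | u in M x].

Definition op_inv M : H -> set H := fun y => [set x | M x y].

Definition zer M : set H := [set x | M x 0].

(* The resolvent is kept set-valued, as the inverse of Id + M; it is
   single-valued with full domain when [M] is maximally monotone. *)
Definition resolvent M : H -> set H := op_inv (op_add (op_of_fun idfun) M).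

Variable dot : {dot H for (@idfun R)}.

Definition monotone_op M : Prop :=
  forall x y u v, M x u -> M y v -> 0 <= dot (x - y) (u - v).

Definition maximally_monotone M : Prop :=
  monotone_op M /\
  forall N, monotone_op N -> (forall x, M x `<=` N x) -> N = M.

Definition cvg_weakly (u : nat -> H) (l : H) : Prop :=
  forall y, dot (u n) y @[n --> \oo] --> dot l y.

End SetValuedOperators.

(* The value at [k] of the sequence [k |-> x_(k-1)], where [xm1] is x_(-1). *)
Definition prev_iterate (T : Type) (xm1 : T) (x : nat -> T) (k : nat) : T :=
  if k is k'.+1 then x k' else xm1.

(* Main.v *)
Require Import Defs.
From HB Require Import structures.
From mathcomp Require Import all_boot all_order all_algebra.
From mathcomp Require Import all_classical all_reals all_analysis.
From mathcomp Require Import ring lra.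

Set Implicit Arguments.
Unset Strict Implicit.
Unset Printing Implicit Defensive.

Import Order.TTheory GRing.Theory Num.Theory.
Import numFieldNormedType.Exports.

Local Open Scope classical_set_scope.
Local Open Scope ring_scope.

(** Write [z_k = x_k + lam B x_(k-1)] and, for a zero [s] of [A + B],
    [z_s = s + lam B s].  The monotonicity of [A] and [B] and the Lipschitz bound
    show that [|z_k - z_s|^2 + 1/3 |x_k - x_(k-1)|^2] decreases by at least
    [(1/3 - 3 (lam L)^2) |x_k - x_(k-1)|^2] at each step ([energy_descent], from
    the algebraic identity behind [energy_inequality]).  Since [lam L < 1/3], the
    increments [x_k - x_(k-1)] tend to [0] strongly, [|z_k - z_s|] converges for
    every zero [s], and the iterates are bounded.

    Weak cluster points are taken along ultrafilters finer than the filter at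
    infinity: bounded sequences converge weakly along them ([ultra_weak_limit],
    by compactness of segments and the Riesz representation), and convergence
    along all of them is convergence ([cvg_ultra]).  Along such an ultrafilter,
    let [xbar] and [b] be the weak limits of [x_k] and [B x_k].  The elements of
    [A] given by the resolvent are asymptotically [- B x_k], so
    [demiclosed_sum] yields [A xbar (- b)] and [b = B xbar]: the pair of limits
    is determined by the zero [xbar] of [A + B], and [z_k] converges weakly to
    [xbar + lam B xbar].

    It remains to see that [xbar] does not depend on the ultrafilter.  As
    [|z_k - z_s|] converges for every zero [s], Opial's argument ([opial_unique])
    shows that the limit of [z_k] does not, and [Id + lam B] is injective.  The
    same zero is thus the weak limit of [x_k], and its image that of
    [B x_k]. *)

(** * Inner products inducing the norm *)

Section InnerProduct.
Variables (R : realType) (H : normedModType R) (dot : {dot H for (@idfun R)}).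
Implicit Types (x y h : H).

Lemma dotC x y : dot x y = dot y x.
Proof. by rewrite hermC expr0 mul1r. Qed.

Lemma dotDl x y h : dot (x + y) h = dot x h + dot y h.
Proof. exact: linearDl. Qed.

Lemma dotDr x y h : dot h (x + y) = dot h x + dot h y.
Proof. exact: linearDr. Qed.

Lemma dotNl x h : dot (- x) h = - dot x h.
Proof. exact: linearNl. Qed.

Lemma dotNr x h : dot h (- x) = - dot h x.
Proof. exact: linearNr. Qed.

Lemma dotZl a x h : dot (a *: x) h = a * dot x h.
Proof. exact: linearZl_LR. Qed.

Lemma dotZr a x h : dot h (a *: x) = a * dot h x.
Proof. by rewrite dotC dotZl dotC. Qed.

Definition dot_expand := (dotDl, dotDr, dotNl, dotNr, dotZl, dotZr).

Lemma dot_ge0 x : 0 <= dot x x.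
Proof.
have [->|x0] := eqVneq x 0; first by rewrite (linear0r dot 0).
exact/ltW/neq0_dnorm_gt0.
Qed.

Lemma dot_eq0 x : dot x x = 0 -> x = 0.
Proof.
move=> xx0; apply: contraTeq isT => x0.
by have := @neq0_dnorm_gt0 _ _ _ dot x x0; rewrite xx0 ltxx.
Qed.

Hypothesis dot_norm : induces_norm dot.

Lemma normE x : `|x| ^+ 2 = dot x x.
Proof. by rewrite dot_norm sqr_sqrtr ?dot_ge0. Qed.

Lemma cauchy_schwarz x y : `|dot x y| <= `|x| * `|y|.
Proof.
have [->|y0] := eqVneq y 0; first by rewrite (linear0r dot x) !normr0 mulr0.
rewrite -(@ler_pXn2r _ 2) ?nnegrE ?mulr_ge0 //.
rewrite exprMn !normE real_normK ?num_real //.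
have yy : 0 < dot y y by exact: neq0_dnorm_gt0.
have := dot_ge0 (dot y y *: x - dot x y *: y).
rewrite !dot_expand (dotC y x) => xy.
rewrite -(ler_pM2l yy); lra.
Qed.

Lemma dot_le x y : dot x y <= `|x| * `|y|.
Proof. exact: le_trans (ler_norm _) (cauchy_schwarz x y). Qed.

Section Filters.
Context {T : Type} {F : set_system T} {FF : Filter F}.

Lemma squeeze0 (f g : T -> R) : (forall n, `|f n| <= g n) ->
  g n @[n --> F] --> 0 -> f n @[n --> F] --> 0.
Proof.
move=> fg g0; apply/norm_cvg0P.
apply: (@squeeze_cvgr _ _ _ _ (cst 0) g); last 2 first.
- exact: cvg_cst.
- exact: g0.
by apply: nearW => n; rewrite normr_ge0 fg.
Qed.

(** The error terms of [demiclosed_sum] pair a strongly null family with a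
    bounded one, for which only weak convergence is known. *)
Lemma cvg0_dot_bounded (f g : T -> H) (M : R) : (forall n, `|g n| <= M) ->
  `|f n| @[n --> F] --> 0 -> dot (f n) (g n) @[n --> F] --> 0.
Proof.
move=> gM f0; apply: (@squeeze0 _ (fun n => `|f n| * M)) => [n|].
  by apply: le_trans (cauchy_schwarz _ _) _; rewrite ler_wpM2l.
by rewrite -(mul0r M); apply: cvgM => //; exact: cvg_cst.
Qed.

End Filters.

(** One step of the scheme around a zero [s], written with the displacements
    [u = x_k - s], [u' = x_(k+1) - s] and the images
    [v = lam B x_k - lam B s], [v' = lam B x_(k-1) - lam B s].  The first two
    hypotheses are the monotonicity of [A] and of [B].  Added up, they give
    [|u' + v|^2 + |d|^2 - 4 <d, e> + 3 |e|^2 <= |u + v'|^2] for [d = u - u'] and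
    [e = v - v'], and [|d - 3 e|^2 >= 0] absorbs the cross term.  The weight
    [1/3] left on [|d|^2] balances [3 q] exactly when [lam L = 1/3]. *)
Lemma energy_inequality (u u' v v' : H) (q : R) :
  0 <= dot (u' + (v - v')) (u - u' - (v - v') - v) ->
  0 <= dot u v -> `|v - v'| ^+ 2 <= q ->
  `|u' + v| ^+ 2 + 3^-1 * `|u' - u| ^+ 2 <= `|u + v'| ^+ 2 + 3 * q.
Proof.
have := dot_ge0 ((u - u') - 3 *: (v - v')).
rewrite !normE !dot_expand.
rewrite !(dotC v u) !(dotC v' u) !(dotC v u') !(dotC v' u').
rewrite !(dotC v' v) !(dotC u' u); lra.
Qed.

End InnerProduct.

(** * Riesz representation *)

Section Riesz.
Variables (R : realType) (H : completeNormedModType R).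
Variables (dot : {dot H for (@idfun R)}) (dot_norm : induces_norm dot).

(** The representing vector minimises [J x = <x, x> - 2 phi x].  By the
    parallelogram law, the sublevel sets of [J] near its infimum [m] have small
    diameter, so the filter they generate is Cauchy and converges to some [l]
    with [J l <= m]; the first-order condition at [l] is the representation. *)
Lemma riesz_representation (phi : H -> R) (M : R) :
  (forall x y, phi (x + y) = phi x + phi y) ->
  (forall a x, phi (a *: x) = a * phi x) ->
  (forall x, `|phi x| <= M * `|x|) ->
  exists l, forall x, phi x = dot l x.
Proof.
move=> phiD phiZ phiM.
pose J x := dot x x - 2 * phi x.
pose m := inf (range J).
have J_lb x : - M ^+ 2 <= J x.
  have := phiM x; rewrite /J -(normE dot_norm) ler_norml => /andP[_ phix].
  have := sqr_ge0 (`|x| - M); lra.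
have has_lbJ : has_lbound (range J) by exists (- M ^+ 2) => _ [x _ <-].
have J_ge x : m <= J x by apply: ge_inf => //; exists x.
have J_near e : 0 < e -> exists x, J x < m + e.
  move=> e0; have [|_ [x _ <-] ?] := @inf_adherent _ (range J) _ e0.
    by split => //; exists (J 0), 0.
  by exists x.
have phiN x : phi (- x) = - phi x by rewrite -scaleN1r phiZ mulN1r.
(* The midpoint of x and y also satisfies J >= m. *)
have J_close x y e : J x < m + e -> J y < m + e -> dot (x - y) (x - y) < 4 * e.
  move=> Jx Jy; have := J_ge (2^-1 *: (x + y)); move: Jx Jy.
  rewrite /J phiZ phiD !dot_expand (dotC dot y x); lra.
pose S e := [set x | J x < m + e].
pose F := filter_from [set e | 0 < e] S.
have FF : Filter F.
  apply: filter_from_filter; first by exists 1 => /=.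
  move=> i j /= i0 j0; exists (Num.min i j); first by rewrite /= lt_min i0.
  by move=> x; rewrite /S /= -ltrBlDl lt_min !ltrBlDl => /andP.
have PF : ProperFilter F.
  by apply: filter_from_proper => e e0; exact: J_near.
have /cauchy_cvgP /cvg_ex[l Fl] : cauchy F.
  apply: cauchy_exP => e e0.
  have e4 : 0 < e ^+ 2 / 4 by rewrite divr_gt0 ?exprn_gt0.
  have [x Jx] := J_near _ e4; exists x; exists (e ^+ 2 / 4) => //= y Jy.
  rewrite -ball_normE /= -(@ltr_pXn2r _ 2) ?nnegrE ?(ltW e0) //.
  rewrite (normE dot_norm).
  have := J_close _ _ _ Jx Jy; lra.
have Jl : J l <= m.
  apply/ler_addgt0Pr => e e0.
  pose c := 1 + 2 * (`|l| + `|M|).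
  have c0 : 0 < c by rewrite ltr_pwDl // mulr_ge0 // addr_ge0.
  have ec : 0 < e / c by rewrite divr_gt0.
  have FS : F (S (e / c)) by exists (e / c).
  have /cvgrPdist_lt/(_ _ ec) FB : id @ F --> l by exact: Fl.
  have [x [Jx xl]] := filter_ex (filterI FS FB).
  have {}xl : `|l - x| < e / c by [].
  have := phiM (l - x); rewrite ler_norml => /andP[lo _].
  have := dot_le dot_norm (l - x) l; have := dot_ge0 dot (l - x).
  have lx0 := normr_ge0 (l - x); have M0 := normr_ge0 M; have l0 := normr_ge0 l.
  have : M * `|l - x| <= `|M| * `|l - x| by rewrite ler_wpM2r // ler_norm.
  have : `|l - x| * c < e by rewrite -ltr_pdivlMr.
  move: Jx lo; rewrite /S /= /J phiD phiN !dot_expand (dotC dot x l) /c => *.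
  have ecm : e / c * c = e by rewrite divfK // gt_eqF.
  have : e / c + (e / c) * (2 * (`|l| + `|M|)) = e by rewrite -{3}ecm /c; ring.
  have : `|l - x| * (`|l| + `|M|) <= (e / c) * (`|l| + `|M|).
    by rewrite ler_wpM2r ?addr_ge0 // ltW.
  lra.
exists l => h; set c := dot l h - phi h.
suff: c = 0 by rewrite /c; lra.
have hh := dot_ge0 dot h.
have q0 : 0 < dot h h + 1 by lra.
(* The optimal step towards h is c / <h, h>; adding 1 to the denominator
   covers h = 0. *)
have := J_ge (l - (c / (dot h h + 1)) *: h).
have := Jl; rewrite {1 2}/J phiD phiN phiZ !dot_expand (dotC dot h l).
set t := c / _ => Jl1 Jl2.
have ct : c = t * (dot h h + 1) by rewrite /t divfK // gt_eqF.
have : 0 <= - 2 * t * c + t ^+ 2 * dot h h by rewrite /c; lra.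
rewrite {1}ct => tt; suff -> : c = 0 by [].
have t2 : t ^+ 2 <= 0 by have := mulr_ge0 (sqr_ge0 t) hh; lra.
have /eqP : t ^+ 2 = 0 by apply/eqP; rewrite eq_le t2 sqr_ge0.
by rewrite sqrf_eq0 => /eqP t0; rewrite ct t0 mul0r.
Qed.

End Riesz.

(** * Weak limits along ultrafilters *)

Section UltrafilterLimits.

Lemma fmap_ultra (T Y : Type) (f : T -> Y) (U : set_system T) :
  UltraFilter U -> UltraFilter (f @ U).
Proof.
move=> UU; split=> [|G GF UG]; first exact: fmap_proper_filter.
rewrite predeqE => A; split; last exact: UG.
move=> GA; have [//|UnA] := in_ultra_setVsetC (f @^-1` A) UU.
have GnA : G (~` A) by apply: UG.
by have [y []] := filter_ex (filterI GA GnA).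
Qed.

(** Convergence can be tested on the finer ultrafilters: if some neighbourhood
    [A] of [l] fails, an ultrafilter containing [F] and the complement of the
    preimage of [A] does not converge to [l].  This replaces the extraction of
    subsequences. *)
Lemma cvg_ultra (T : Type) (Y : topologicalType) (F : set_system T)
    (f : T -> Y) (l : Y) : Filter F ->
  (forall U, UltraFilter U -> F `<=` U -> f @ U --> l) -> f @ F --> l.
Proof.
move=> FF fU A Al; apply: contrapT => nFA.
pose G := within (~` (f @^-1` A)) F.
have GF : ProperFilter G.
  apply: Build_ProperFilter_ex.
  move=> B GB; apply: contrapT => B0; apply: nFA.
  apply: (@filterS _ F FF _ _ _ GB) => n Bn.
  by apply: contrapT => nA; apply: B0; exists n; exact: Bn.
have [U [UU GU]] := ultraFilterLemma GF.
have FU : F `<=` U.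
  by move=> B FB; apply: GU; apply: filterS FB => n Bn _.
have UnA : U (~` (f @^-1` A)) by apply: GU; exact: withinT.
have UA : U (f @^-1` A) := fU U UU FU A Al.
by have [n [An nAn]] := filter_ex (filterI UA UnA).
Qed.

Lemma subfilter_cvg (T : Type) (Y : topologicalType) (f : T -> Y) (l : Y)
    (F U : set_system T) : F `<=` U -> f @ F --> l -> f @ U --> l.
Proof. by move=> FU fl S Sl; apply: FU; exact: fl. Qed.

Lemma ultra_cvg_segment (R : realType) (T : Type) (U : set_system T)
    (f : T -> R) (M : R) : UltraFilter U -> (forall n, `|f n| <= M) ->
  exists2 l, `|l| <= M & f @ U --> l.
Proof.
move=> UU fM; have := @segment_compact R (- M) M; rewrite compact_ultra.
move=> /(_ (f @ U) (fmap_ultra f UU)) [|l [lM fl]].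
  have Umem : U [set n | f n \in `[- M, M]].
    by apply: filterE => n /=; rewrite in_itv /= -ler_norml.
  exact: Umem.
by exists l => //; rewrite ler_norml; move: lM; rewrite /= in_itv.
Qed.

Variables (R : realType) (H : completeNormedModType R).
Variables (dot : {dot H for (@idfun R)}) (dot_norm : induces_norm dot).

(** Weak compactness of balls: along an ultrafilter every bounded real family
    [dot (u n) h] has a limit, which is a bounded linear function of [h], hence
    is given by a vector. *)
Lemma ultra_weak_limit (T : Type) (U : set_system T) (u : T -> H) (M : R) :
  UltraFilter U -> (forall n, `|u n| <= M) ->
  exists l, forall h, dot (u n) h @[n --> U] --> dot l h.
Proof.
move=> UU uM.
have lim h : exists l : R, `|l| <= M * `|h| /\ dot (u n) h @[n --> U] --> l.
  have [|l lM ul] := @ultra_cvg_segment R T U (fun n => dot (u n) h)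
    (M * `|h|) UU; last by exists l.
  move=> n; apply: le_trans (cauchy_schwarz dot_norm _ _) _.
  by rewrite ler_wpM2r.
have [phi phiP] := choice lim.
have [x y|a x|x|l lP] := @riesz_representation R H dot dot_norm phi M.
- apply: (cvg_unique (@Rhausdorff R) (phiP (x + y)).2).
  have -> : (fun n => dot (u n) (x + y)) =
      (fun n => dot (u n) x) \+ (fun n => dot (u n) y).
    by apply/funext => n; exact: dotDr.
  by apply: cvgD; [exact: (phiP x).2|exact: (phiP y).2].
- apply: (cvg_unique (@Rhausdorff R) (phiP (a *: x)).2).
  have -> : (fun n => dot (u n) (a *: x)) = (fun n => a * dot (u n) x).
    by apply/funext => n; exact: dotZr.
  by apply: cvgM; [exact: cvg_cst|exact: (phiP x).2].
- exact: (phiP x).1.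
by exists l => h; rewrite -lP; exact: (phiP h).2.
Qed.

(** Opial's argument: [2 <u n, z1 - z2>] equals
    [|u n - z2|^2 - |u n - z1|^2] up to a constant, so it has a limit along the
    coarse filter.  The limits of [<u n, z1 - z2>] along [U1] and [U2], which are
    [<z1, z1 - z2>] and [<z2, z1 - z2>], are therefore equal. *)
Lemma opial_unique (T : Type) (F U1 U2 : set_system T) (u : T -> H)
    (z1 z2 : H) (l1 l2 : R) :
  Filter F -> ProperFilter U1 -> ProperFilter U2 -> F `<=` U1 -> F `<=` U2 ->
  `|u n - z1| ^+ 2 @[n --> F] --> l1 -> `|u n - z2| ^+ 2 @[n --> F] --> l2 ->
  (forall h, dot (u n) h @[n --> U1] --> dot z1 h) ->
  (forall h, dot (u n) h @[n --> U2] --> dot z2 h) ->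
  z1 = z2.
Proof.
move=> FF PU1 PU2 FU1 FU2 ul1 ul2 uw1 uw2.
pose r := 2^-1 * (l2 - l1 + (dot z1 z1 - dot z2 z2)).
have ur : dot (u n) (z1 - z2) @[n --> F] --> r.
  have -> : (fun n => dot (u n) (z1 - z2)) = (fun n => 2^-1 *
      (`|u n - z2| ^+ 2 - `|u n - z1| ^+ 2 + (dot z1 z1 - dot z2 z2))).
    apply/funext => n; rewrite !(normE dot_norm) !dot_expand.
    by rewrite (dotC dot z1 (u n)) (dotC dot z2 (u n)); field.
  apply: cvgM; first exact: cvg_cst.
  by apply: cvgD; [exact: cvgB|exact: cvg_cst].
have r1 : dot z1 (z1 - z2) = r.
  by apply: (cvg_unique (@Rhausdorff R) (uw1 _)); exact: subfilter_cvg ur.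
have r2 : dot z2 (z1 - z2) = r.
  by apply: (cvg_unique (@Rhausdorff R) (uw2 _)); exact: subfilter_cvg ur.
apply/eqP; rewrite -subr_eq0; apply/eqP.
by apply: (dot_eq0 (dot := dot)); rewrite dotDl dotNl r1 r2 subrr.
Qed.

End UltrafilterLimits.

(** * Maximal monotonicity and demiclosedness *)

Section MonotoneOperators.
Variables (R : realType) (H : normedModType R).
Variables (dot : {dot H for (@idfun R)}) (dot_norm : induces_norm dot).

(** Otherwise adding [(x, y)] to the graph of [A] would give a strictly larger
    monotone operator. *)
Lemma maximally_monotone_mem (A : H -> set H) (x y : H) :
  maximally_monotone dot A ->
  (forall u v, A u v -> 0 <= dot (x - u) (y - v)) -> A x y.
Proof.
move=> [A_mono A_max] xy.
pose N z := A z `|` [set w | z = x /\ w = y].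
rewrite -(A_max N); first by right.
- move=> a b u v [Au|[-> ->]] [Av|[-> ->]].
  + exact: A_mono.
  + rewrite -(opprB x a) -(opprB y u) dotNl dotNr opprK; exact: xy.
  + exact: xy.
  + by rewrite !subrr (linear0r dot).
- by move=> z w Aw; left.
Qed.

Variables (B : H -> H) (B_mono : monotone_op dot (op_of_fun B)).
Variables (L : R) (L_gt0 : 0 < L) (B_lip : L.-lipschitz B).

Lemma lipschitzE x y : `|B x - B y| <= L * `|x - y|.
Proof. exact: (B_lip (x := (x, y))). Qed.

Lemma monotoneE x y : 0 <= dot (x - y) (B x - B y).
Proof. exact: B_mono. Qed.

(** Minty's trick.  Taking [w = x + t (b - B x)] and using the Lipschitz bound
    gives [|b - B x|^2 <= t L |b - B x|^2]; the step [t = 1 / (2 L)] leaves no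
    room, so no limit [t -> 0] is needed. *)
Lemma minty_lipschitz x b :
  (forall w, 0 <= dot (x - w) (b - B w)) -> b = B x.
Proof.
move=> xb; apply/eqP; rewrite -subr_eq0; apply/eqP.
apply: (dot_eq0 (dot := dot)).
set g := b - B x; pose t := (2 * L)^-1.
have t0 : 0 < t by rewrite invr_gt0 mulr_gt0.
have := xb (x + t *: g).
rewrite opprD addrA subrr add0r dotNl dotZl -mulrN pmulr_rge0 // => gg.
have := dot_le dot_norm g (B (x + t *: g) - B x).
have := lipschitzE (x + t *: g) x.
rewrite addrAC subrr add0r normrZ (gtr0_norm t0) => Bl.
have {Bl} : `|g| * `|B (x + t *: g) - B x| <= `|g| * (L * (t * `|g|)).
  by rewrite ler_wpM2l.
have -> : `|g| * (L * (t * `|g|)) = dot g g / 2.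
  by rewrite -(normE dot_norm) /t; field; rewrite gt_eqF.
move: gg; have := dot_ge0 dot g.
have -> : b - B (x + t *: g) = g - (B (x + t *: g) - B x).
  by rewrite /g opprB addrA subrK.
rewrite (dotDr _ g) dotNr => *; lra.
Qed.

Variables (A : H -> set H) (A_max : maximally_monotone dot A).

(** Pairing [(p n, a n)] with [(u, v)] in the graph of [A] and [(x n, B (x n))]
    with [(w, B w)] produces quadratic terms whose sum is
    [<x n, a n + B (x n)> + <p n - x n, a n>], which tends to [0].  What remains
    is linear in the weakly convergent data, and in the limit
    [0 <= <xbar - u, - b - v> + <xbar - w, b - B w>] for all [(u, v)] and [w].
    A pair [(u, v)] making the first term nonpositive gives [b = B xbar] by
    [minty_lipschitz]; then [w = xbar] cancels the second term and maximality
    gives the inclusion. *)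
Lemma demiclosed_sum (T : Type) (F : set_system T) (p a x : T -> H)
    (xbar b : H) (M : R) : ProperFilter F ->
  (forall n, A (p n) (a n)) ->
  (forall n, `|x n| <= M) -> (forall n, `|a n| <= M) ->
  `|p n - x n| @[n --> F] --> 0 -> `|a n + B (x n)| @[n --> F] --> 0 ->
  (forall h, dot (x n) h @[n --> F] --> dot xbar h) ->
  (forall h, dot (B (x n)) h @[n --> F] --> dot b h) ->
  A xbar (- b) /\ b = B xbar.
Proof.
move=> FF Apa xM aM px0 aB0 xw Bw.
have key u v w : A u v ->
    0 <= dot (xbar - u) (- b - v) + dot (xbar - w) (b - B w).
  move=> Auv.
  pose S n := dot (p n - u) (a n - v) + dot (x n - w) (B (x n) - B w).
  pose lin n := dot (B (x n)) (u - w) - dot (x n) (v + B w) +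
    (dot u v + dot w (B w)).
  pose err n := dot (a n + B (x n)) (x n - u) + dot (p n - x n) (a n - v).
  have SE : S = lin \+ err.
    apply/funext => n; rewrite /S /lin /err /= !dot_expand.
    rewrite (dotC dot (B (x n)) (x n)) (dotC dot (B (x n)) w).
    by rewrite (dotC dot (a n) u) (dotC dot (a n) (x n)); ring.
  have S_cvg : S n @[n --> F] -->
      dot b (u - w) - dot xbar (v + B w) + (dot u v + dot w (B w)) + (0 + 0).
    rewrite SE; apply: cvgD; [apply: cvgD; [apply: cvgB|exact: cvg_cst]|].
    - exact: Bw.
    - exact: xw.
    - apply: cvgD.
      + apply: (cvg0_dot_bounded dot_norm (M := M + `|u|)) => // n.
        by apply: le_trans (ler_normB _ _) _; rewrite lerD2r.
      + apply: (cvg0_dot_bounded dot_norm (M := M + `|v|)) => // n.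
        by apply: le_trans (ler_normB _ _) _; rewrite lerD2r.
  suff : 0 <= dot b (u - w) - dot xbar (v + B w) +
      (dot u v + dot w (B w)) + (0 + 0).
    congr (0 <= _); rewrite !dot_expand (dotC dot b u) (dotC dot b w).
    by rewrite !(dotC dot _ b); ring.
  have S_ge0 n : 0 <= S n by rewrite addr_ge0 ?monotoneE //; exact: A_max.1.
  rewrite -(cvg_lim (@Rhausdorff R) S_cvg); apply: limr_ge.
    by apply/cvg_ex; eexists; exact: S_cvg.
  exact: nearW.
have Bb : b = B xbar.
  apply: minty_lipschitz => w.
  (* A pair (u, v) with <xbar - u, - b - v> <= 0: the pair (xbar, - b) itself
     if it lies in the graph of A, and otherwise one given by maximality. *)
  have [Ab|nAb] := pselect (A xbar (- b)).
    by have := key _ _ w Ab; rewrite subrr dotC (linear0r dot) add0r.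
  suff [u [v [Auv uv]]] : exists u v, A u v /\ dot (xbar - u) (- b - v) < 0.
    have := key _ _ w Auv; lra.
  apply: contrapT => no; apply: nAb.
  apply: maximally_monotone_mem => // u v Auv.
  by rewrite leNgt; apply/negP => uv; apply: no; exists u, v.
split=> //; apply: maximally_monotone_mem => // u v Auv.
by have := key u v xbar Auv; rewrite subrr (dotC dot 0) (linear0r dot) addr0.
Qed.

End MonotoneOperators.

(** * Energy descent and weak convergence of the iterates *)

Section ShadowDouglasRachford.
Variables (R : realType) (H : completeNormedModType R).
Variables (dot : {dot H for (@idfun R)}) (dot_norm : induces_norm dot).

Variables (A : H -> set H) (A_max : maximally_monotone dot A).
Variables (B : H -> H) (B_mono : monotone_op dot (op_of_fun B)).
Variables (L : R) (L_gt0 : 0 < L) (B_lip : L.-lipschitz B).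
Variables (lam : R) (lam_gt0 : 0 < lam) (lamL : lam * L < 3^-1).
Variables (xm1 : H) (x : nat -> H).

Let prev := prev_iterate xm1 x.

(** [p k] is the resolvent point of the step and [a k] the element of [A (p k)]
    that certifies it.  The descent estimate controls the distances of [z], rather
    than those of [x], to fixed points. *)
Let p k := x k.+1 + lam *: (B (x k) - B (prev k)).
Let a k := lam^-1 *: (x k - lam *: B (x k) - p k).
Let z k := x k + lam *: B (prev k).

Hypothesis A_pa : forall k, A (p k) (a k).

Lemma lam_neq0 : lam != 0. Proof. by rewrite gt_eqF. Qed.

Section FixedZero.
Variables (s : H) (As : A s (- B s)).

(** The memory term [1/3 |x_k - x_(k-1)|^2] pays for the error
    [lam (B x_k - B x_(k-1))] of the next step. *)
Let energy k : R :=
  `|z k - (s + lam *: B s)| ^+ 2 + 3^-1 * `|x k - prev k| ^+ 2.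

Lemma lipschitz_lam y y' : `|lam *: B y - lam *: B y'| <= lam * L * `|y - y'|.
Proof.
rewrite -scalerBr normrZ gtr0_norm // -mulrA ler_pM2l //.
exact: lipschitzE.
Qed.

(** [energy_inequality] at step [k], the Lipschitz bound giving
    [q = (lam L |x_k - x_(k-1)|)^2]. *)
Lemma energy_descent k :
  energy k.+1 + (3^-1 - 3 * (lam * L) ^+ 2) * `|x k - prev k| ^+ 2 <= energy k.
Proof.
have := @energy_inequality _ _ dot dot_norm (x k - s) (x k.+1 - s)
  (lam *: B (x k) - lam *: B s) (lam *: B (prev k) - lam *: B s)
  ((lam * L * `|x k - prev k|) ^+ 2).
have -> : lam *: B (x k) - lam *: B s - (lam *: B (prev k) - lam *: B s) =
   lam *: B (x k) - lam *: B (prev k).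
  by rewrite opprB addrA subrK.
have sum u v : u - s + (v - lam *: B s) = u + v - (s + lam *: B s).
  by rewrite opprD addrACA.
have diff u v : u - s - (v - s) = u - v by rewrite opprB addrA subrK.
have regroup (X X' Y D S : H) : X - Y - (X' + D) + S = X - X' - D - (Y - S).
  rewrite (opprD X') addrACA (opprB Y) -!addrA; congr (_ + (_ + _)).
  by rewrite addrC -addrA.
rewrite !sum !diff => step.
have : energy k.+1 <= `|z k - (s + lam *: B s)| ^+ 2 +
   3 * (lam * L * `|x k - prev k|) ^+ 2.
  apply: step.
  - have := A_max.1 _ _ _ _ (A_pa k) As.
    rewrite -(pmulr_rge0 _ lam_gt0) -dotZr opprK scalerDr.
    congr (0 <= dot _ _).
      by rewrite /p scalerBr; exact: addrAC.
    rewrite /a scalerA divff ?lam_neq0 // scale1r /p scalerBr.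
    exact: regroup.
  - by rewrite -scalerBr dotZr pmulr_rge0 // monotoneE.
  - by rewrite ler_pXn2r ?nnegrE ?mulr_ge0 ?(ltW lam_gt0) ?(ltW L_gt0) //
      lipschitz_lam.
rewrite /energy exprMn; lra.
Qed.

Lemma energy_ge0 k : 0 <= energy k.
Proof. by rewrite addr_ge0 ?mulr_ge0 ?exprn_ge0. Qed.

Lemma energy_gap_gt0 : 0 < 3^-1 - 3 * (lam * L) ^+ 2.
Proof.
have : 0 < lam * L by rewrite mulr_gt0.
move: lamL; nra.
Qed.

Lemma energy_nonincreasing : {homo energy : n m / (n <= m)%N >-> m <= n}.
Proof.
apply/nonincreasing_seqP => k; apply: le_trans (energy_descent k).
by rewrite lerDl mulr_ge0 ?exprn_ge0 // ltW // energy_gap_gt0.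
Qed.

Lemma energy_cvg : exists l : R, energy k @[k --> \oo] --> l.
Proof.
exists (inf (range energy)).
apply: nonincreasing_cvgn; first exact: energy_nonincreasing.
by exists 0 => _ [k _ <-]; exact: energy_ge0.
Qed.

Lemma step_cvg0 : `|x k - prev k| @[k --> \oo] --> (0 : R).
Proof.
have [l Vl] := energy_cvg.
have V0 : energy k - energy k.+1 @[k --> \oo] --> 0.
  rewrite -(subrr l); apply: cvgB => //.
  by rewrite (cvg_shiftS energy).
pose c := 3^-1 - 3 * (lam * L) ^+ 2.
have sq0 : `|x k - prev k| ^+ 2 @[k --> \oo] --> 0.
  apply: (@squeeze0 _ _ _ _ _
    (fun k => c^-1 * (energy k - energy k.+1))) => [k|].
    rewrite ger0_norm ?exprn_ge0 // ler_pdivlMl ?energy_gap_gt0 //.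
    have := energy_descent k; rewrite /c; lra.
  by rewrite -(mulr0 c^-1); apply: cvgM => //; exact: cvg_cst.
have -> : (fun k => `|x k - prev k|) =
    (fun k => Num.sqrt (`|x k - prev k| ^+ 2)).
  by apply/funext => k; rewrite sqrtr_sqr normr_id.
rewrite -sqrtr0; apply: cvg_comp sq0 _; exact: sqrt_continuous.
Qed.

(** The energy converges and its memory term tends to [0]. *)
Lemma shadow_distance_cvg :
  exists l : R, `|z k - (s + lam *: B s)| ^+ 2 @[k --> \oo] --> l.
Proof.
have [l Vl] := energy_cvg; exists (l - 3^-1 * (0 * 0)).
have -> : (fun k => `|z k - (s + lam *: B s)| ^+ 2) =
  (fun k => energy k - 3^-1 * (`|x k - prev k| * `|x k - prev k|)).
  by apply/funext => k; rewrite /energy expr2; ring.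
apply: cvgB => //; apply: cvgM; first exact: cvg_cst.
by apply: cvgM; exact: step_cvg0.
Qed.

(** The energy bounds [z], and [x_k - s] differs from the displacement of [z] by
    [lam (B x_(k-1) - B s)], of norm at most a third of [|x_(k-1) - s|]; the bound
    then propagates by induction. *)
Lemma iterates_bounded : exists M, forall k, `|x k| <= M /\ `|prev k| <= M.
Proof.
(* C is chosen so that (1 + energy 0) + C / 3 <= C, and 1 + energy 0 bounds
   the square root of the energy. *)
pose C := `|xm1 - s| + 2 * (1 + energy 0).
have e00 := energy_ge0 0.
have zM k : `|z k - (s + lam *: B s)| <= 1 + energy 0.
  have : energy k <= energy 0 by exact: energy_nonincreasing.
  have := normr_ge0 (z k - (s + lam *: B s)).
  have := sqr_ge0 `|x k - prev k|; rewrite {1}/energy; nra.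
have next k : `|prev k - s| <= C -> `|x k - s| <= C.
  move=> pk.
  have -> : x k - s = (z k - (s + lam *: B s)) -
      (lam *: B (prev k) - lam *: B s).
    by rewrite /z opprD addrACA addrK.
  apply: le_trans (ler_normB _ _) _.
  have := lipschitz_lam (prev k) s; have := zM k.
  have : lam * L * `|prev k - s| <= 3^-1 * C.
    by apply: ler_pM => //; apply: ltW => //; exact: mulr_gt0.
  have := normr_ge0 (xm1 - s); rewrite /C; lra.
have pM k : `|prev k - s| <= C.
  elim: k => [|k IHk]; last exact: next.
  by rewrite /prev /= /C; lra.
have shift y : `|y - s| <= C -> `|y| <= C + `|s|.
  move=> yC; rewrite -(subrK s y); apply: le_trans (ler_normD _ _) _.
  by rewrite lerD2r.
by exists (C + `|s|) => k; split; apply: shift => //; exact: next.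
Qed.

End FixedZero.

Variables (s : H) (As : A s (- B s)).

(** The iterates [x], [p] are asymptotically equal and [a + B x] tends to [0]
    strongly, so [demiclosed_sum] applies to weak limits along [U]. *)
Lemma ultra_limit_zero (U : set_system nat) :
  UltraFilter U -> \oo `<=` U ->
  exists xbar, [/\ A xbar (- B xbar),
    forall h, dot (x k) h @[k --> U] --> dot xbar h,
    forall h, dot (B (x k)) h @[k --> U] --> dot (B xbar) h &
    forall h, dot (z k) h @[k --> U] --> dot (xbar + lam *: B xbar) h].
Proof.
move=> UU ooU.
have [M xM] := iterates_bounded As.
have M0 : 0 <= M by exact: le_trans (normr_ge0 _) (xM 0).1.
have BxM y : `|y| <= M -> `|B y| <= L * M + `|B 0|.
  move=> yM; rewrite -(subrK (B 0) (B y)); apply: le_trans (ler_normD _ _) _.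
  rewrite lerD2r; apply: le_trans (lipschitzE B_lip _ _) _.
  by rewrite subr0 ler_pM2l.
have st0 := subfilter_cvg ooU (step_cvg0 As).
have st0S : `|x k.+1 - x k| @[k --> U] --> 0.
  apply: subfilter_cvg ooU _.
  by have := step_cvg0 As; rewrite -(cvg_shiftS (fun k => `|x k - prev k|)).
have dB0 : `|lam *: B (x k) - lam *: B (prev k)| @[k --> U] --> 0.
  apply: (@squeeze0 _ _ _ _ _ (fun k => lam * L * `|x k - prev k|)) => [k|].
    by rewrite normr_id lipschitz_lam.
  by rewrite -(mulr0 (lam * L)); apply: cvgM => //; exact: cvg_cst.
have px0 : `|p k - x k| @[k --> U] --> 0.
  apply: (@squeeze0 _ _ _ _ _ (fun k => `|x k.+1 - x k| +
     `|lam *: B (x k) - lam *: B (prev k)|)) => [k|].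
    by rewrite normr_id /p scalerBr addrAC ler_normD.
  by rewrite -(addr0 0); apply: cvgD.
have aBE k : a k + B (x k) = - (lam^-1 *: (p k - x k)).
  rewrite /a -[in RHS]scalerN opprB (addrAC (x k)) scalerBr.
  rewrite scalerA mulVf ?lam_neq0 // scale1r.
  by rewrite subrK.
have aB0 : `|a k + B (x k)| @[k --> U] --> 0.
  have -> : (fun k => `|a k + B (x k)|) = (fun k => lam^-1 * `|p k - x k|).
    by apply/funext => k; rewrite aBE normrN normrZ gtr0_norm ?invr_gt0.
  by rewrite -(mulr0 lam^-1); apply: cvgM => //; exact: cvg_cst.
(* The three summands bound x k, B (x k) and lam^-1 (p k - x k); the last two
   are what a k = - B (x k) - lam^-1 (p k - x k) requires. *)
pose M' := M + (L * M + `|B 0|) + lam^-1 * (M + (M + lam * L * (M + M))).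
have LM : 0 <= L * M + `|B 0| by rewrite addr_ge0 // mulr_ge0 // ltW.
have xM' k : `|x k| <= M'.
  apply: le_trans (xM k).1 _; rewrite /M' -addrA lerDl addr_ge0 //.
  by rewrite !(mulr_ge0, addr_ge0) ?invr_ge0 ?(ltW lam_gt0) ?(ltW L_gt0).
have aM' k : `|a k| <= M'.
  rewrite -(addrK (B (x k)) (a k)) aBE.
  apply: le_trans (ler_normB _ _) _.
  rewrite normrN normrZ gtr0_norm ?invr_gt0 //.
  rewrite addrC; apply: lerD.
    by apply: le_trans (BxM _ (xM k).1) _; rewrite lerDr.
  rewrite ler_pM2l ?invr_gt0 //.
  have xk := (xM k).1; have xk1 : `|x k.+1| <= M by exact: (xM k.+1).1.
  apply: le_trans (ler_normB _ _) _; rewrite addrC; apply: lerD => //.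
  apply: le_trans (ler_normD _ _) _; apply: lerD => //.
  rewrite scalerBr; apply: le_trans (lipschitz_lam _ _) _.
  rewrite ler_pM2l ?mulr_gt0 //; apply: le_trans (ler_normB _ _) _.
  by apply: lerD => //; exact: (xM k).2.
have [xbar xw] := ultra_weak_limit dot_norm UU xM'.
have [b Bw] := ultra_weak_limit dot_norm UU (fun k => BxM _ (xM k).1).
have [Axb bB] := demiclosed_sum dot_norm B_mono L_gt0 B_lip A_max
  (@ultra_proper _ _ UU) A_pa xM' aM' px0 aB0 xw Bw.
rewrite bB in Axb Bw.
exists xbar; split=> // h.
have -> : (fun k => dot (z k) h) = (fun k => dot (x k) h +
    lam * dot (B (x k)) h - dot (lam *: B (x k) - lam *: B (prev k)) h).
  by apply/funext => k; rewrite /z !dot_expand; ring.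
rewrite dotDl dotZl -[X in _ --> X]subr0; apply: cvgB; last first.
  exact: (cvg0_dot_bounded dot_norm (M := `|h|)).
apply: cvgD; first exact: xw.
by apply: cvgM; [exact: cvg_cst|exact: Bw].
Qed.

(** [Id + lam B] is strongly monotone. *)
Lemma id_add_scale_inj y y' :
  y + lam *: B y = y' + lam *: B y' -> y = y'.
Proof.
move=> yy; apply/eqP; rewrite -subr_eq0; apply/eqP/(dot_eq0 (dot := dot)).
have : dot (y - y') (y + lam *: B y - (y' + lam *: B y')) = 0.
  by rewrite yy subrr (linear0r dot).
rewrite opprD addrACA -scalerBr (dotDr _ (y - y')) dotZr.
have := mulr_ge0 (ltW lam_gt0) (monotoneE B_mono y y').
have := dot_ge0 dot (y - y'); lra.
Qed.

(** By [shadow_distance_cvg] and [opial_unique], the limits of [z] along all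
    ultrafilters agree; by injectivity of [Id + lam B] so do those of [x], hence
    those of [B x]. *)
Lemma shadow_weak_convergence : exists2 xbar, A xbar (- B xbar) &
  cvg_weakly dot x xbar /\ cvg_weakly dot (fun k => B (x k)) (B xbar).
Proof.
have [U [UU ooU]] := @ultraFilterLemma _ \oo _.
have [xbar [Axb _ _ zw]] := ultra_limit_zero UU ooU.
have unique W : UltraFilter W -> \oo `<=` W ->
    (forall h, dot (x k) h @[k --> W] --> dot xbar h) /\
    (forall h, dot (B (x k)) h @[k --> W] --> dot (B xbar) h).
  move=> WU ooW; have [y [Ay xw Bw zyw]] := ultra_limit_zero WU ooW.
  suff -> : xbar = y by [].
  have [l1 zl1] := shadow_distance_cvg Axb.
  have [l2 zl2] := shadow_distance_cvg Ay.
  apply: id_add_scale_inj.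
  exact: (opial_unique dot_norm _ _ _ ooU ooW zl1 zl2 zw zyw).
exists xbar => //; split=> h; apply: cvg_ultra => W WU ooW.
- exact: (unique W WU ooW).1.
- exact: (unique W WU ooW).2.
Qed.

End ShadowDouglasRachford.

Theorem theorem3 (R : realType) (H : completeNormedModType R)
    (dot : {dot H for (@idfun R)}) (dot_norm : induces_norm dot)
    (A : H -> set H) (A_max : maximally_monotone dot A)
    (B : H -> H) (B_mono : monotone_op dot (op_of_fun B))
    (L : R) (L_gt0 : 0 < L) (B_lip : L.-lipschitz B)
    (zer_nonempty : zer (op_add A (op_of_fun B)) !=set0)
    (eps : R) (eps_gt0 : 0 < eps)
    (lam : R) (lam_range : lam \in `[eps, (1 - 3 * eps) / (3 * L)])
    (x0 xm1 : H) (x : nat -> H) (x_init : x 0%N = x0)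
    (x_step : forall k : nat,
       exists2 p : H,
         resolvent (op_scale lam A) (x k - lam *: B (x k)) p &
         x k.+1 = p - lam *: (B (x k) - B (prev_iterate xm1 x k))) :
  exists2 xbar : H, zer (op_add A (op_of_fun B)) xbar &
    cvg_weakly dot x xbar /\ cvg_weakly dot (fun k => B (x k)) (B xbar).
Proof.
move: lam_range; rewrite in_itv /= => /andP[eps_lam lam_le].
have lam_gt0 : 0 < lam by exact: lt_le_trans eps_lam.
have lamL : lam * L < 3^-1.
  move: lam_le; rewrite ler_pdivlMr ?mulr_gt0 //; lra.
have [s [u As [_ /= -> us]]] := zer_nonempty.
have {us}uE : u = - B s by apply/eqP; rewrite -addr_eq0 us.
rewrite {}uE in As.
have A_pa k : A (x k.+1 + lam *: (B (x k) - B (prev_iterate xm1 x k)))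
    (lam^-1 *: (x k - lam *: B (x k) -
       (x k.+1 + lam *: (B (x k) - B (prev_iterate xm1 x k))))).
  have [p [_ /= -> [_ [w Aw <-] pw]] ->] := x_step k.
  rewrite subrK -pw addrAC subrr add0r scalerA mulVf ?gt_eqF // scale1r.
  exact: Aw.
have [xbar Axb cv] := shadow_weak_convergence dot_norm A_max B_mono L_gt0 B_lip
  lam_gt0 lamL A_pa As.
exists xbar => //; exists (- B xbar) => //; exists (B xbar) => //.
by rewrite addNr.
Qed.
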